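(* Let $\Omega\subset\mathbb{R}^n$ be either (i) a bounded domain, or (ii) an unbounded domain such that for some $h>1$ the cone $$K_h=\Bigl\{x\in\mathbb{R}^n:\ x_n^2>h^2\sum_{i=1}^{n-1}x_i^2,\ x_n<0\Bigr\}$$ belongs to the complement of $\Omega$. Let $\mathcal{B}_{jk}=\mathcal{B}_{kj}$ ($1\le j,k\le n$) be bounded real $(m\times m)$-matrix-valued functions in $\Omega\times\mathbb{R}^{mn}$, and assume that the quasilinear operator $$\mathfrak{B}(x,D_x)\boldsymbol u=\sum_{j,k=1}^n\mathcal{B}_{jk}(x,D_x\boldsymbol u)\frac{\partial^2\boldsymbol u}{\partial x_j\partial x_k},\qquad\boldsymbol u=(u_1,\dots,u_m),$$ is uniformly strongly elliptic in $\Omega$, i.e. there is a constant $\delta>0$ such that $$\Bigl(\sum_{j,k=1}^n\mathcal{B}_{jk}(x,\boldsymbol\eta)\sigma_j\sigma_k\boldsymbol\zeta,\boldsymbol\zeta\Bigr)\ge\delta|\boldsymbol\sigma|^2|\boldsymbol\zeta|^2$$ for all $\boldsymbol\eta\in\mathbb{R}^{mn}$, $\boldsymbol\sigma=(\sigma_1,\dots,\sigma_n)\in\mathbb{R}^n$, $\boldsymbol\zeta\in\mathbb{R}^m$ and $x\in\Omega$. Let $\mathfrak{S}$ be a convex body in $\mathbb{R}^m$, and suppose that there are functions $b_{jk}:\Omega\times\mathbb{R}^{mn}\times\mathfrak{N}_{\mathfrak{S}}\to\mathbb{R}$, $1\le j,k\le n$, such that $${}^t\mathcal{B}_{jk}(x,\boldsymbol\eta)\boldsymbol\nu=b_{jk}(x,\boldsymbol\eta;\boldsymbol\nu)\boldsymbol\nu$$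 for all $x\in\Omega$, $\boldsymbol\eta\in\mathbb{R}^{mn}$ and $\boldsymbol\nu\in\mathfrak{N}_{\mathfrak{S}}$. Then $\mathfrak{S}$ is invariant for the system $\mathfrak{B}(x,D_x)\boldsymbol u=\boldsymbol 0$ in $\Omega$.
   Context: $|\cdot|$ and $(\cdot,\cdot)$ denote the Euclidean length and inner product, ${}^t\mathcal{B}$ is the transpose of the matrix $\mathcal{B}$, and $D_x\boldsymbol u\in\mathbb{R}^{mn}$ is the collection of all first-order partial derivatives of the components of $\boldsymbol u$. Convex body: a convex body $\mathfrak{S}$ in $\mathbb{R}^m$ is the closure of a convex proper subdomain (nonempty open convex set, not all of $\mathbb{R}^m$); it may be unbounded. $\partial^*\mathfrak{S}$ is the set of points $a\in\partial\mathfrak{S}$ at which the unit outward normal $\boldsymbol\nu(a)$ to $\partial\mathfrak{S}$ exists, and $\mathfrak{N}_{\mathfrak{S}}=\{\boldsymbol\nu(a):a\in\partial^*\mathfrak{S}\}$. Invariance: a set $\mathcal{S}\subset\mathbb{R}^m$ is called invariant for a second-order elliptic system in a domain $\Omega$ if every bounded classical solution $\boldsymbol u=(u_1,\dots,u_m)$ of the system which is continuous in $\overline\Omega$ (that is, $\boldsymbol u\in C^2(\Omega;\mathbb{R}^m)\cap C_b(\overline\Omega;\mathbb{R}^m)$) and satisfies $\boldsymbol u(x)\in\mathcal{S}$ for all $x\in\partial\Omega$ takes values in $\mathcal{S}$ everywhere in $\Omega$. *)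

(* Defs.v *)
From HB Require Import structures.
From mathcomp Require Import all_boot all_order all_algebra.
From mathcomp Require Import all_classical all_reals all_analysis.
Import Order.TTheory GRing.Theory Num.Theory.
Import numFieldNormedType.Exports.

Set Implicit Arguments.
Unset Strict Implicit.
Unset Printing Implicit Defensive.

Local Open Scope classical_set_scope.
Local Open Scope ring_scope.

(* Points x, sigma of R^n are row vectors, values u, zeta, nu in R^m are column
   vectors, and R^(mn) is 'M[R]_(m, n). The library norm on matrices is the sup
   norm: it is used only for topology and boundedness, which agree with the
   Euclidean ones; lengths and inner products are the Euclidean ones below. *)

Definition inner (R : realType) (p q : nat) (v w : 'M[R]_(p, q)) : R :=
  \sum_i \sum_j v i j * w i j.

Definition enorm (R : realType) (p q : nat) (v : 'M[R]_(p, q)) : R :=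
  Num.sqrt (inner v v).

Definition boundary (T : topologicalType) (A : set T) : set T :=
  closure A `\` interior A.

Definition is_domain (R : realType) (n : nat) (Omega : set 'rV[R]_n) : Prop :=
  [/\ open Omega, connected Omega & Omega !=set0].

Definition cone (R : realType) (n : nat) (h : R) : set 'rV[R]_n.+1 :=
  [set x | h ^+ 2 * (\sum_(i < n.+1 | i != ord_max) x 0 i ^+ 2)
             < x 0 ord_max ^+ 2 /\ x 0 ord_max < 0].

Definition convex_body (R : realType) (m : nat) (S : set 'cV[R]_m) : Prop :=
  exists D : set 'cV[R]_m,
    [/\ open D, convex_set D, D !=set0, D <> setT & S = closure D].

Definition outward_normal (R : realType) (m : nat) (S : set 'cV[R]_m)
    (a nu : 'cV[R]_m) : Prop :=
  [/\ boundary S a, enorm nu = 1 & forall y, S y -> inner (y - a) nu <= 0].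

(* For a convex body every boundary point has some supporting hyperplane; "the
   unit outward normal at a exists" means that it is unique, so that nu(a) is
   well defined. *)
Definition regular_boundary (R : realType) (m : nat) (S : set 'cV[R]_m) :
    set 'cV[R]_m :=
  [set a | boundary S a /\ exists! nu, outward_normal S a nu].

Definition normals (R : realType) (m : nat) (S : set 'cV[R]_m) : set 'cV[R]_m :=
  [set nu | exists2 a, regular_boundary S a & outward_normal S a nu].

Section Derivatives.
Variables (R : realType) (n m : nat).
Implicit Types (u : 'rV[R]_n -> 'cV[R]_m) (x : 'rV[R]_n).

Definition pd (j : 'I_n) u : 'rV[R]_n -> 'cV[R]_m := 'D_(delta_mx 0 j) u.

Definition pd_exists (j : 'I_n) u x : Prop := derivable u x (delta_mx 0 j).

(* Meaningful for open Omega only: derivatives are taken in the ambient space. *)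
Definition C2_on (Omega : set 'rV[R]_n) u : Prop :=
  [/\ {in Omega, continuous u},
      forall j, (forall x, Omega x -> pd_exists j u x) /\
                {in Omega, continuous (pd j u)} &
      forall j k, (forall x, Omega x -> pd_exists j (pd k u) x) /\
                  {in Omega, continuous (pd j (pd k u))}].

Definition grad u x : 'M[R]_(m, n) := \matrix_(i, j) pd j u x i 0.

Definition quasilinear_op (B : 'I_n -> 'I_n -> 'rV[R]_n -> 'M[R]_(m, n) -> 'M[R]_m)
    u x : 'cV[R]_m :=
  \sum_(j < n) \sum_(k < n) B j k x (grad u x) *m pd j (pd k u) x.

Definition strongly_elliptic (Omega : set 'rV[R]_n)
    (B : 'I_n -> 'I_n -> 'rV[R]_n -> 'M[R]_(m, n) -> 'M[R]_m) : Prop :=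
  exists2 delta : R, 0 < delta &
    forall (eta : 'M[R]_(m, n)) (sigma : 'rV[R]_n) (zeta : 'cV[R]_m) x,
      Omega x ->
      delta * enorm sigma ^+ 2 * enorm zeta ^+ 2 <=
      inner ((\sum_(j < n) \sum_(k < n)
                (sigma 0 j * sigma 0 k) *: B j k x eta) *m zeta) zeta.

(* L is the operator of the system L u = 0. *)
Definition invariant_for (L : ('rV[R]_n -> 'cV[R]_m) -> 'rV[R]_n -> 'cV[R]_m)
    (Omega : set 'rV[R]_n) (S : set 'cV[R]_m) : Prop :=
  forall u, C2_on Omega u ->
    {within closure Omega, continuous u} ->
    [bounded u x | x in closure Omega] ->
    (forall x, Omega x -> L u x = 0) ->
    (forall x, boundary Omega x -> S (u x)) ->
    forall x, Omega x -> S (u x).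

End Derivatives.

(* Main.v *)
(* A point [a] of a convex body [S] touched by a ball inside [S] has a unique
   outward normal, and the half-spaces [(y - a, nu) <= 0] at such points cut out
   [S]. For each of them [w = (u - a, nu)] solves the scalar equation
   [sum b_jk w_jk = 0], because [nu] is an eigenvector of every [tB_jk]; the
   coefficients [b_jk] are bounded and elliptic, and [w <= 0] on the boundary. The
   geometric hypotheses give, for each point [x0] of [Omega], a ball in the
   complement of radius [rho] at distance comparable to [rho] from [x0];
   comparison with a Gaussian centred at that ball yields [w x0 <= (1 - th) sup w]
   with [th > 0] independent of [x0], whence [sup w <= 0]. *)

Require Import Defs.
From HB Require Import structures.
From mathcomp Require Import all_boot all_order all_algebra.
From mathcomp Require Import all_classical all_reals all_analysis.
From mathcomp Require Import ring lra.
Import Order.TTheory GRing.Theory Num.Theory.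
Import numFieldNormedType.Exports.

Local Open Scope classical_set_scope.
Local Open Scope ring_scope.

Set Implicit Arguments.
Unset Strict Implicit.
Unset Printing Implicit Defensive.

(** * Second-order conditions at a maximum *)

Lemma sum_sum_recl (R : comRingType) (n : nat) (F : 'I_n.+1 -> 'I_n.+1 -> R) :
  \sum_i \sum_j F i j = F ord0 ord0 + \sum_j F ord0 (lift ord0 j)
    + \sum_i F (lift ord0 i) ord0 + \sum_i \sum_j F (lift ord0 i) (lift ord0 j).
Proof.
rewrite big_ord_recl big_ord_recl.
under [X in _ + X]eq_bigr do rewrite big_ord_recl.
by rewrite big_split /= !addrA.
Qed.

(* Induction on the size: with [a = b 0 0], [b] is [a^-1] times the square of
   its first row plus the Schur complement, which is again positive definite. *)
Lemma posdef_negsemidef_trace_le0 (R : realFieldType) (n : nat)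
    (b H : 'I_n -> 'I_n -> R) :
  (forall j k, b j k = b k j) ->
  (forall s i, s i != 0 -> 0 < \sum_j \sum_k s j * s k * b j k) ->
  (forall s, \sum_j \sum_k s j * s k * H j k <= 0) ->
  \sum_j \sum_k b j k * H j k <= 0.
Proof.
elim: n b H => [|n IH] b H bsym bpos Hneg; first by rewrite big_ord0.
pose a := b ord0 ord0; pose v j := b ord0 (lift ord0 j).
pose ext (t : R) (s : 'I_n -> R) i := if unlift ord0 i is Some j then s j else t.
have ext0 t s : ext t s ord0 = t by rewrite /ext unlift_none.
have extl t s j : ext t s (lift ord0 j) = s j by rewrite /ext liftK.
have extE t s (F : 'I_n.+1 -> 'I_n.+1 -> R) :
    \sum_j \sum_k ext t s j * ext t s k * F j k =
    t ^+ 2 * F ord0 ord0 + t * \sum_j s j * (F ord0 (lift ord0 j) + F (lift ord0 j) ord0)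
    + \sum_j \sum_k s j * s k * F (lift ord0 j) (lift ord0 k).
  rewrite sum_sum_recl !ext0 -expr2; congr (_ + _); last first.
    by apply: eq_bigr => j _; apply: eq_bigr => k _; rewrite !extl.
  rewrite -addrA -big_split mulr_sumr; congr (_ + _); apply: eq_bigr => j _ /=.
  by rewrite !extl; ring.
have a0 : 0 < a.
  have := bpos (ext 1 (fun=> 0)) ord0; rewrite ext0 oner_eq0 => /(_ isT).
  rewrite extE big1 => [|j _]; last by rewrite mul0r.
  rewrite [X in _ + X]big1 => [|j _]; last by rewrite big1 => // k _; rewrite !mul0r.
  by rewrite expr1n mul1r mulr0 !addr0.
pose b' j k := b (lift ord0 j) (lift ord0 k) - a^-1 * v j * v k.
have {}IH : \sum_j \sum_k b' j k * H (lift ord0 j) (lift ord0 k) <= 0.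
  apply: IH => [j k|s i si|s]; rewrite ?/b'.
  - by rewrite bsym; ring.
  (* This [t] minimises the form over the first coordinate; the minimum is the Schur complement [b']
     evaluated at [s]. *)
  - pose t := - a^-1 * \sum_j s j * v j.
    have := bpos (ext t s) (lift ord0 i); rewrite extl => /(_ si).
    rewrite extE; congr (0 < _).
    have -> : \sum_j s j * (b ord0 (lift ord0 j) + b (lift ord0 j) ord0) =
              2 * \sum_j s j * v j.
      rewrite mulr_sumr; apply: eq_bigr => j _.
      by rewrite (bsym (lift _ _)) /v; ring.
    have -> : \sum_j \sum_k s j * s k * (b (lift ord0 j) (lift ord0 k) - a^-1 * v j * v k)
       = \sum_j \sum_k s j * s k * b (lift ord0 j) (lift ord0 k) -
         a^-1 * (\sum_j s j * v j) ^+ 2.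
      rewrite expr2 mulr_suml mulr_sumr -sumrB; apply: eq_bigr => j _.
      rewrite !mulr_sumr -sumrB; apply: eq_bigr => k _; ring.
    by rewrite -/a /t; field; rewrite gt_eqF.
  - by have := Hneg (ext 0 s); rewrite extE expr0n !mul0r !add0r.
(* The vector [ext a v] is the first row of [b]. The trace times [a] is the form of [H] at this row
   plus [a] times the trace for [b'], and both terms are nonpositive. *)
have := Hneg (ext a v); rewrite extE => Hav.
rewrite -(pmulr_rle0 _ a0).
have -> : a * \sum_j \sum_k b j k * H j k =
    (a ^+ 2 * H ord0 ord0 +
      a * (\sum_j v j * (H ord0 (lift ord0 j) + H (lift ord0 j) ord0)) +
      \sum_j \sum_k v j * v k * H (lift ord0 j) (lift ord0 k)) +
    a * \sum_j \sum_k b' j k * H (lift ord0 j) (lift ord0 k).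
  rewrite sum_sum_recl -/a -[X in a * (X + _)]addrA -big_split /=.
  have -> : \sum_j \sum_k v j * v k * H (lift ord0 j) (lift ord0 k) =
      a * \sum_j \sum_k (a^-1 * v j * v k) * H (lift ord0 j) (lift ord0 k).
    rewrite mulr_sumr; apply: eq_bigr => j _; rewrite mulr_sumr.
    by apply: eq_bigr => k _; field; rewrite gt_eqF.
  have -> : \sum_j \sum_k b (lift ord0 j) (lift ord0 k) * H (lift ord0 j) (lift ord0 k)
    = \sum_j \sum_k (a^-1 * v j * v k) * H (lift ord0 j) (lift ord0 k) +
      \sum_j \sum_k b' j k * H (lift ord0 j) (lift ord0 k).
    rewrite -big_split; apply: eq_bigr => j _ /=; rewrite -big_split.
    by apply: eq_bigr => k _ /=; rewrite /b'; ring.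
  have -> : \sum_j (b ord0 (lift ord0 j) * H ord0 (lift ord0 j) +
                    b (lift ord0 j) ord0 * H (lift ord0 j) ord0) =
            \sum_j v j * (H ord0 (lift ord0 j) + H (lift ord0 j) ord0).
    by apply: eq_bigr => j _; rewrite (bsym (lift _ _)) /v; ring.
  by ring.
by rewrite -[leRHS]addr0 lerD// pmulr_rle0.
Qed.

(** The mean value theorem gives [g a - g 0 = g' c * a] with [c] between [0] and [a]. All signs of
    [a] are covered because it will be an increment [h * s]. *)
Lemma le_increment (R : realType) (g g' : R -> R) (a L e : R) :
  (forall t : R, `|t| <= `|a| -> is_derive t 1 g (g' t)) ->
  (forall t, `|t| <= `|a| -> `|g' t - L| <= e) ->
  `|g a - g 0 - L * a| <= e * `|a|.
Proof.
move=> dg bg.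
have cg t : `|t| <= `|a| -> {for t, continuous g}.
  move=> ta; apply/differentiable_continuous/derivable1_diffP.
  exact: (@ex_derive _ _ _ _ _ _ _ (dg t ta)).
have [a0|a0|->] := ltgtP a 0; last by rewrite subrr mulr0 subrr normr0 mulr0.
- have [||c] := @MVT R g g' a 0 a0.
  + move=> t; rewrite in_itv /= => /andP[t1 t2]; apply: dg.
    by rewrite !ltr0_norm//; lra.
  + apply: continuous_in_subspaceT => t; rewrite inE /= in_itv /= => /andP[t1 t2].
    by apply: cg; rewrite ler0_norm// ltr0_norm//; lra.
  rewrite in_itv /= => /andP[t1 t2] E.
  have -> : g a - g 0 - L * a = (g' c - L) * a by lra.
  by rewrite normrM ler_wpM2r// bg// !ltr0_norm//; lra.
- have [||c] := @MVT R g g' 0 a a0.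
  + move=> t; rewrite in_itv /= => /andP[t1 t2]; apply: dg.
    by rewrite !gtr0_norm//; lra.
  + apply: continuous_in_subspaceT => t; rewrite inE /= in_itv /= => /andP[t1 t2].
    by apply: cg; rewrite ger0_norm// gtr0_norm//; lra.
  rewrite in_itv /= => /andP[t1 t2] E.
  have -> : g a - g 0 - L * a = (g' c - L) * a by lra.
  by rewrite normrM ler_wpM2r// bg// !gtr0_norm//; lra.
Qed.

(** Since [g' 0 = 0], a positive [D] would make [g' t / t] positive near [0], and [g] would increase
    to the right of its maximum. *)
Lemma second_derivative_at_max (R : realType) (g g' : R -> R) (r D : R) :
  0 < r -> (forall t : R, `|t| < r -> is_derive t 1 g (g' t)) ->
  is_derive (0 : R) 1 g' D -> (forall t, `|t| < r -> g t <= g 0) -> D <= 0.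
Proof.
move=> r0 dg dg' gmax; rewrite leNgt; apply/negP => D0.
have itvE t : t \in `](- r), r[ -> `|t| < r by rewrite in_itv ltr_norml.
have g'0 : g' 0 = 0.
  have d0 : is_derive (0 : R) 1 g 0.
    apply: (@derive1_at_max R g (- r) r 0) => [|t /itvE /dg ? //||t /itvE /gmax//].
      by lra.
    by rewrite in_itv /=; lra.
  have := dg 0; rewrite normr0 => /(_ r0) d1.
  by case: d1 => _ <-; case: d0.
have : (fun h => h^-1 *: ((g' \o shift 0) (h *: 1) - g' 0)) @ 0^' --> D.
  by case: dg' => dg'1 <-; exact: dg'1.
move/cvgrPdist_lt/(_ D D0) => [e /= e0 He].
pose t0 := Num.min (r / 2) (e / 2).
have t00 : 0 < t0 by rewrite lt_min !divr_gt0.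
have t0r : t0 < r by rewrite gt_min ltr_pdivrMr// ltr_pMr// ltrDl ltr01.
have t0e : t0 < e by rewrite gt_min orbC ltr_pdivrMr// ltr_pMr// ltrDl ltr01.
have [||c] := @MVT R g g' 0 t0 t00.
- move=> t; rewrite in_itv /= => /andP[t1 t2]; apply: dg.
  by rewrite gtr0_norm//; lra.
- apply: continuous_in_subspaceT => t; rewrite inE /= in_itv /= => /andP[t1 t2].
  apply/differentiable_continuous/derivable1_diffP.
  by apply: (@ex_derive _ _ _ _ _ _ _ (dg t _)); rewrite ger0_norm//; lra.
rewrite in_itv /= => /andP[/= c0 ct] E.
have := He c; rewrite /ball_ /= sub0r normrN gtr0_norm// gt_eqF// => /(_ (lt_trans ct t0e) isT).
rewrite g'0 subr0 addr0 [_%:A]mulr1 ltr_norml => /andP[_ h].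
have : 0 < g' c.
  rewrite -(@pmulr_rgt0 _ c^-1) ?invr_gt0//.
  by move: h; rewrite /GRing.scale /=; lra.
have := gmax t0; rewrite gtr0_norm// => /(_ t0r) gm g'c.
have : 0 < g' c * (t0 - 0) by rewrite mulr_gt0// subr0.
by rewrite -E; lra.
Qed.

Lemma is_derive_line (R : numFieldType) (V W : normedModType R) (f : V -> W)
    (x v : V) (t : R) (d : W) :
  is_derive (x + t *: v) v f d -> is_derive t 1 (fun t => f (x + t *: v)) d.
Proof.
have E : (fun h => h^-1 *: (((fun t => f (x + t *: v)) \o shift t) (h *: 1) - f (x + t *: v)))
    = (fun h => h^-1 *: ((f \o shift (x + t *: v)) (h *: v) - f (x + t *: v))).
  apply/funext => h /=; congr (_ *: (f _ - _)).
  by rewrite [_%:A]mulr1 scalerDl addrCA.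
by move=> [d1 d2]; split; rewrite /derivable /derive E.
Qed.

(** The increment along [h (v + s w)] is one along [h v] followed by one along [h s w]; the mean
    value theorem controls the second since [P] is continuous at [x]. Along [v] a derivative is
    asked at [x] only, so directions can be added one at a time. *)
Lemma is_derive_add (R : realType) (V : normedModType R) (f P : V -> R)
    (x v w : V) (d s : R) :
  (\forall y \near x, is_derive y w f (P y)) -> {for x, continuous P} ->
  is_derive x v f d -> is_derive x (v + s *: w) f (d + s * P x).
Proof.
move=> dw cP [dv dvE].
suff H : (fun h => h^-1 *: ((f \o shift x) (h *: (v + s *: w)) - f x)) @ 0^' --> d + s * P x.
  by split; [apply/cvg_ex; exists (d + s * P x)|exact: cvg_lim].
have E : (fun h => h^-1 *: ((f \o shift x) (h *: (v + s *: w)) - f x)) =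
    (fun h => h^-1 *: ((f \o shift x) (h *: v) - f x) +
       h^-1 * (f (x + h *: v + (h * s) *: w) - f (x + h *: v))).
  apply/funext => h; rewrite /= [LHS]/GRing.scale /= [X in _ = X + _]/GRing.scale /=.
  rewrite (addrC (h *: v)) (_ : h *: (v + s *: w) + x = x + h *: v + (h * s) *: w).
    by ring.
  by rewrite scalerDr scalerA addrC addrA.
rewrite E; apply: cvgD; first by rewrite -dvE; exact: dv.
apply/cvgrPdist_le => e e0.
(* Dividing the error [e' * |h s|] by [h] leaves [e' * |s| <= e]; the [+ 1] covers [s = 0]. *)
pose e' := e / (`|s| + 1).
have e'0 : 0 < e' by rewrite divr_gt0// ltr_wpDl.
have : \forall y \near x, is_derive y w f (P y) /\ `|P x - P y| <= e'.
  by near=> y; split; [near: y; exact: dw|near: y; exact: (cvgrPdist_le _ _).1 cP _ e'0].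
move=> /nbhs_ballP[r /= r0 Hr].
(* The whole segment traversed along [w] stays within [|h| * K] of [x]. *)
pose K := `|v| + `|s| * `|w| + 1.
have K0 : 0 < K by rewrite ltr_wpDl// addr_ge0// mulr_ge0.
near=> h.
have h0 : h != 0 by near: h; exact: nbhs_dnbhs_neq.
have hr : `|h| < r / K by near: h; apply: dnbhs0_lt; rewrite divr_gt0.
have inball t : `|t| <= `|h * s| -> ball x r (x + h *: v + t *: w).
  move=> ths; rewrite -ball_normE /ball_ /= -addrA opprD addNKr normrN.
  rewrite (le_lt_trans (ler_normD _ _))// !normrZ.
  apply: (@le_lt_trans _ _ (`|h| * K)); last by rewrite -ltr_pdivlMr.
  rewrite /K !mulrDr mulr1 -[leRHS]addrA lerD2l mulrA -normrM.
  by rewrite (le_trans (ler_wpM2r _ ths))// lerDl.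
have Hh : `|f (x + h *: v + (h * s) *: w) - f (x + h *: v) - P x * (h * s)| <= e' * `|h * s|.
  rewrite -[in X in _ - X - _](addr0 (x + h *: v)) -[in X in _ - X - _](scale0r w).
  apply: (@le_increment R (fun t => f (x + h *: v + t *: w))
    (fun t => P (x + h *: v + t *: w))) => t /inball/Hr[dt Pt].
  - exact: is_derive_line.
  - by rewrite distrC.
have -> : s * P x - h^-1 * (f (x + h *: v + (h * s) *: w) - f (x + h *: v)) =
  - h^-1 * (f (x + h *: v + (h * s) *: w) - f (x + h *: v) - P x * (h * s)) by field.
rewrite normrM normrN normfV ler_pdivrMl ?normr_gt0// (le_trans Hh)//.
rewrite normrM mulrCA ler_wpM2l// /e' mulrAC ler_pdivrMr ?ltr_wpDl//.
by rewrite ler_pM2l// lerDl.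
Unshelve. all: by end_near. Qed.

(** Passes from the partial derivatives, which are all that [C2_on] provides, to directional ones by
    adding the coordinates of [s] one by one. *)
Lemma is_derive_partials (R : realType) (n : nat) (f : 'rV[R]_n -> R)
    (P : 'I_n -> 'rV[R]_n -> R) (x s : 'rV[R]_n) :
  (forall j, \forall y \near x, is_derive y (delta_mx 0 j) f (P j y)) ->
  (forall j, {for x, continuous (P j)}) ->
  is_derive x s f (\sum_j s 0 j * P j x).
Proof.
move=> dP cP; rewrite [s in is_derive _ s]row_sum_delta.
elim: (index_enum _) => [|j l IH]; first by rewrite !big_nil; exact: is_derive0.
by rewrite !big_cons addrC (addrC (_ * _)); exact: is_derive_add.
Qed.

(** [k s] is the restriction to the line of direction [s] of a comparison function added to [w].
    Giving it line by line reduces its calculus to one variable. *)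
Lemma second_directional_at_max (R : realType) (n : nat) (w : 'rV[R]_n -> R)
    (P : 'I_n -> 'rV[R]_n -> R) (Q : 'I_n -> 'I_n -> 'rV[R]_n -> R)
    (U : set 'rV[R]_n) (x : 'rV[R]_n) (k k' : 'rV[R]_n -> R -> R)
    (k'' : 'rV[R]_n -> R) :
  open U -> U x ->
  (forall j y, U y -> is_derive y (delta_mx 0 j) w (P j y)) ->
  (forall i j y, U y -> is_derive y (delta_mx 0 i) (P j) (Q i j y)) ->
  (forall j, {in U, continuous (P j)}) ->
  (forall i j, {in U, continuous (Q i j)}) ->
  (forall s (t : R), is_derive t 1 (k s) (k' s t)) ->
  (forall s, is_derive (0 : R) 1 (k' s) (k'' s)) ->
  (forall s t, U (x + t *: s) -> w (x + t *: s) + k s t <= w x + k s 0) ->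
  forall s : 'rV[R]_n, \sum_i \sum_j s 0 i * s 0 j * Q i j x + k'' s <= 0.
Proof.
move=> oU Ux dP dQ cP cQ dk dk' wmax s.
have Unear y : U y -> \forall z \near y, U z by move=> Uy; exact: open_nbhs_nbhs (conj oU Uy).
have wdir y : U y -> is_derive y s w (\sum_j s 0 j * P j y).
  move=> Uy; apply: is_derive_partials => j; last by apply: cP; rewrite inE.
  by apply: filterS (Unear _ Uy) => z; exact: dP.
have Pdir j y : U y -> is_derive y s (P j) (\sum_i s 0 i * Q i j y).
  move=> Uy; apply: (@is_derive_partials R n (P j) (Q^~ j)) => i; last by apply: cQ; rewrite inE.
  by apply: filterS (Unear _ Uy) => z; exact: dQ.
have [r /= r0 Hr] : exists2 r, 0 < r & forall t, `|t| < r -> U (x + t *: s).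
  have /nbhs_ballP[e /= e0 He] := Unear _ Ux.
  exists (e / (`|s| + 1)); first by rewrite divr_gt0// ltr_wpDl.
  move=> t ht; apply: He; rewrite -ball_normE /ball_ /= opprD addNKr normrN normrZ.
  move: ht; rewrite ltr_pdivlMr ?ltr_wpDl//; apply: le_lt_trans.
  by rewrite ler_wpM2l// lerDl.
apply: (@second_derivative_at_max R (fun t => w (x + t *: s) + k s t)
  (fun t => \sum_j s 0 j * P j (x + t *: s) + k' s t) r) => //.
- move=> t /Hr Ut.
  have d1 : is_derive t 1 (fun t => w (x + t *: s)) (\sum_j s 0 j * P j (x + t *: s)).
    by apply: is_derive_line; exact: wdir.
  exact: (is_deriveD d1 (dk s t)).
- have -> : \sum_i \sum_j s 0 i * s 0 j * Q i j x =
    \sum_j s 0 j * \sum_i s 0 i * Q i j (x + 0 *: s).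
    rewrite exchange_big; apply: eq_bigr => j _; rewrite mulr_sumr.
    by apply: eq_bigr => i _; rewrite scale0r addr0; ring.
  have d1 j : is_derive (0 : R) 1 (fun t => s 0 j *: P j (x + t *: s))
      (s 0 j *: \sum_i s 0 i * Q i j (x + 0 *: s)).
    have d0 : is_derive (0 : R) 1 (fun t => P j (x + t *: s))
        (\sum_i s 0 i * Q i j (x + 0 *: s)).
      by apply: is_derive_line; apply: Pdir; rewrite scale0r addr0.
    exact: (is_deriveZ (s 0 j) d0).
  have d2 := is_derive_sum d1.
  have := is_deriveD d2 (dk' s); congr (is_derive _ _ _ _).
  by apply/funext => t; rewrite /= [LHS]/GRing.add /= fct_sumE.
- by move=> t /Hr Ut; rewrite scale0r addr0; exact: wmax.
Qed.

(** * Euclidean inner product *)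

Section InnerProduct.
Variables (R : realType) (p q : nat).
Implicit Types (v w z : 'M[R]_(p, q)) (a : R).

Lemma inner_sym v w : inner v w = inner w v.
Proof. by apply: eq_bigr => i _; apply: eq_bigr => j _; rewrite mulrC. Qed.

Lemma innerDl v w z : inner (v + w) z = inner v z + inner w z.
Proof.
rewrite -big_split; apply: eq_bigr => i _; rewrite -big_split.
by apply: eq_bigr => j _; rewrite mxE mulrDl.
Qed.

Lemma innerZl a v w : inner (a *: v) w = a * inner v w.
Proof.
rewrite mulr_sumr; apply: eq_bigr => i _; rewrite mulr_sumr.
by apply: eq_bigr => j _; rewrite mxE mulrA.
Qed.

Lemma innerNl v w : inner (- v) w = - inner v w.
Proof. by rewrite -scaleN1r innerZl mulN1r. Qed.

Lemma innerBl v w z : inner (v - w) z = inner v z - inner w z.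
Proof. by rewrite innerDl innerNl. Qed.

Lemma innerDr v w z : inner z (v + w) = inner z v + inner z w.
Proof. by rewrite !(inner_sym z) innerDl. Qed.

Lemma innerZr a v w : inner w (a *: v) = a * inner w v.
Proof. by rewrite !(inner_sym w) innerZl. Qed.

Lemma innerNr v w : inner w (- v) = - inner w v.
Proof. by rewrite !(inner_sym w) innerNl. Qed.

Lemma innerBr v w z : inner z (v - w) = inner z v - inner z w.
Proof. by rewrite innerDr innerNr. Qed.

Lemma inner_subZ v w a : inner (v - a *: w) (v - a *: w) =
  inner v v - 2 * a * inner v w + a ^+ 2 * inner w w.
Proof.
by rewrite innerBl !innerBr !innerZl !innerZr (inner_sym w v); ring.
Qed.

Lemma inner_suml (I : Type) (r : seq I) (P : pred I) (F : I -> 'M[R]_(p, q)) w :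
  inner (\sum_(i <- r | P i) F i) w = \sum_(i <- r | P i) inner (F i) w.
Proof.
apply: (big_morph (fun v => inner v w)) => [v z|]; first exact: innerDl.
by rewrite -(scale0r 0) innerZl mul0r.
Qed.

Lemma inner_ge0 v : 0 <= inner v v.
Proof. by apply: sumr_ge0 => i _; apply: sumr_ge0 => j _; rewrite -expr2 sqr_ge0. Qed.

Lemma enorm_sq v : enorm v ^+ 2 = inner v v.
Proof. by rewrite sqr_sqrtr// inner_ge0. Qed.

Lemma sq_entry_le_inner v i j : v i j ^+ 2 <= inner v v.
Proof.
rewrite /inner (bigD1 i)//= (bigD1 j)//= -addrA -expr2 lerDl addr_ge0//.
  by apply: sumr_ge0 => k _; rewrite -expr2 sqr_ge0.
by apply: sumr_ge0 => l _; apply: sumr_ge0 => k _; rewrite -expr2 sqr_ge0.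
Qed.

Lemma entry_le_enorm v i j : `|v i j| <= enorm v.
Proof. by rewrite -[leLHS]sqrtr_sqr ler_wsqrtr// sq_entry_le_inner. Qed.

Lemma norm_le_enorm v : `|v| <= enorm v.
Proof.
rewrite [leLHS]/Num.Def.normr /= mx_normrE; apply: bigmax_le => [|i _].
  exact: sqrtr_ge0.
exact: entry_le_enorm.
Qed.

Lemma inner_eq0 v : inner v v = 0 -> v = 0.
Proof.
move=> v0; apply/matrixP => i j; rewrite mxE.
apply/eqP; rewrite -sqrf_eq0 eq_le sqr_ge0 andbT -v0; exact: sq_entry_le_inner.
Qed.

Lemma cvg_inner (T : Type) (F : set_system T) (FF : Filter F)
    (f g : T -> 'M[R]_(p, q)) v w :
  f @ F --> v -> g @ F --> w -> (fun x => inner (f x) (g x)) @ F --> inner v w.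
Proof.
move=> fv gw; rewrite /inner.
apply: cvg_big => [|i _]; first exact: add_continuous.
apply: cvg_big => [|j _]; first exact: add_continuous.
have entry (k : T -> 'M[R]_(p, q)) (M : 'M[R]_(p, q)) :
    k @ F --> M -> (fun x => k x i j) @ F --> M i j.
  move=> kM; apply: (@cvg_comp _ _ _ k (fun A : 'M[R]_(p, q) => A i j) F _ _ kM).
  exact: coord_continuous.
by apply: cvgM; exact: entry.
Qed.

Lemma continuous_inner_dist w : continuous (fun v => inner (v - w) (v - w)).
Proof.
move=> v; have h : (fun z : 'M[R]_(p, q) => z - w) @ v --> v - w.
  exact: (cvgB cvg_id (cvg_cst w)).
exact: (cvg_inner (nbhs_filter v) h h).
Qed.

Lemma interior_inner_ball (A : set 'M[R]_(p, q)) w v (r : R) :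
  (forall z, inner (z - w) (z - w) <= r -> A z) ->
  inner (v - w) (v - w) < r -> A° v.
Proof.
move=> wA vr; rewrite /interior /=.
have := @continuous_inner_dist w v _ (lt_nbhsl vr).
by apply: (@filterS _ (nbhs v)) => z /= zr; apply: wA; exact: ltW.
Qed.

(** The Euclidean norm dominates the sup norm that defines the topology; halving the radius makes
    the Euclidean ball closed. *)
Lemma nbhs_inner_ball (A : set 'M[R]_(p, q)) v :
  nbhs v A -> exists2 e, 0 < e & forall w, inner (w - v) (w - v) <= e ^+ 2 -> A w.
Proof.
move=> /nbhs_ballP[e /= e0 eA]; exists (e / 2); first by rewrite divr_gt0.
move=> w wv; apply: eA; rewrite -ball_normE /ball_ /= distrC.
apply: (le_lt_trans (norm_le_enorm _)).
apply: (@le_lt_trans _ _ (e / 2)); last by rewrite ltr_pdivrMr// ltr_pMr// ltrDl.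
have e20 : 0 <= e / 2 by rewrite divr_ge0// ltW.
by rewrite -[leRHS](ger0_norm e20) -[leRHS]sqrtr_sqr ler_wsqrtr.
Qed.

End InnerProduct.

Lemma continuous_trmx (R : realType) (p q : nat) :
  continuous (@trmx R p q).
Proof.
move=> v A /nbhs_ballP[e /= e0 eA]; apply/nbhs_ballP; exists e => // w [_ vw].
by apply: eA; split => // i j; rewrite !mxE; exact: vw.
Qed.

Lemma trmxB (R : realType) (p q : nat) (v w : 'M[R]_(p, q)) : (v - w)^T = v^T - w^T.
Proof. exact: linearB. Qed.

Lemma inner_trmx (R : realType) (p q : nat) (v w : 'M[R]_(p, q)) :
  inner v^T w^T = inner v w.
Proof.
rewrite [RHS]exchange_big; apply: eq_bigr => i _.
by apply: eq_bigr => j _; rewrite !mxE.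
Qed.

Lemma compact_inner_ball_rV (R : realType) (n : nat) (d : 'rV[R]_n) (e : R) :
  compact [set z : 'rV[R]_n | inner (z - d) (z - d) <= e].
Proof.
apply: bounded_closed_compact; last first.
  apply: (@preimage_closed _ _ (fun z : 'rV[R]_n => inner (z - d) (z - d)) [set x | x <= e]).
    by move=> z _; exact: continuous_inner_dist.
  exact: closed_le.
exists (`|d| + Num.sqrt e); split; first exact: num_real.
move=> M hM z /= ze; apply: (le_trans _ (ltW hM)).
rewrite -[in leLHS](subrKC d z) (le_trans (ler_normD _ _))// lerD2l.
by rewrite (le_trans (norm_le_enorm _))// ler_wsqrtr.
Qed.

(** Transposition is continuous and preserves [inner], so the case of row vectors carries over. *)
Lemma compact_inner_ball_cV (R : realType) (m : nat) (d : 'cV[R]_m) (e : R) :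
  compact [set z : 'cV[R]_m | inner (z - d) (z - d) <= e].
Proof.
have -> : [set z : 'cV[R]_m | inner (z - d) (z - d) <= e] =
    trmx @` [set z : 'rV[R]_m | inner (z - d^T) (z - d^T) <= e].
  apply/seteqP; split => [z ze|_ [z ze <-]].
    by exists z^T; rewrite ?trmxK//= -trmxB inner_trmx.
  by rewrite /= -inner_trmx trmxB trmxK.
apply: continuous_compact; first exact/continuous_subspaceT/continuous_trmx.
exact: compact_inner_ball_rV.
Qed.

(** * Convex bodies as intersections of regular half-spaces *)

Section ConvexBodies.
Variables (R : realType) (m : nat).
Implicit Types (S D : set 'cV[R]_m) (a c d p y z nu : 'cV[R]_m).

Lemma closure_convex D x y (t : R) : convex_set D -> closure D x -> closure D y ->
  0 <= t <= 1 -> closure D (t *: x + (1 - t) *: y).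
Proof.
move=> cD cx cy /andP[t0 t1] U /nbhs_ballP[e /= e0 eU].
have e20 : 0 < e / 2 by rewrite divr_gt0.
have [a [Da xa]] := cx _ (nbhsx_ballx x _ e20).
have [b [Db yb]] := cy _ (nbhsx_ballx y _ e20).
exists (t *: a + (1 - t) *: b); split.
  by have := cD a b (Itv01 t0 t1); rewrite !inE => /(_ Da Db).
apply: eU; move: xa yb; rewrite -!ball_normE /ball_ /= => xa yb.
rewrite opprD addrACA -!scalerBr (le_lt_trans (ler_normD _ _))// !normrZ.
rewrite !ger0_norm ?subr_ge0//.
have : t * `|x - a| <= t * (e / 2) by rewrite ler_wpM2l// ltW.
have : (1 - t) * `|y - b| <= (1 - t) * (e / 2) by rewrite ler_wpM2l ?subr_ge0// ltW.
by lra.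
Qed.

(** Convexity with a plain real weight, in place of the bundled weight of [convex_set]. *)
Definition convex_combinations S :=
  forall y z (t : R), S y -> S z -> 0 <= t <= 1 -> S (t *: y + (1 - t) *: z).

(** The homothety [g] of centre [y] takes the given point to [z]; the preimage of [S] under it is a
    neighbourhood of that point and lies in [S]. *)
Lemma interior_convex S y z (t : R) : convex_combinations S -> S y -> S° z ->
  0 <= t < 1 -> S° (t *: y + (1 - t) *: z).
Proof.
move=> cS Sy Sz /andP[t0 t1].
have t10 : 1 - t != 0 by rewrite subr_eq0 gt_eqF.
pose g x := (1 - t)^-1 *: (x - t *: y).
have gE x : x = t *: y + (1 - t) *: g x.
  by rewrite scalerA divff// scale1r addrC subrK.
have cg : {for t *: y + (1 - t) *: z, continuous g}.
  exact: (cvgZr (cvgB cvg_id (cvg_cst _))).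
have : nbhs (g (t *: y + (1 - t) *: z)) S.
  by rewrite /g addrAC subrr add0r scalerA mulVf// scale1r.
move=> /cg cgS; rewrite /interior /=.
apply: (@filterS _ (nbhs _) _ (g @^-1` S)) cgS => x /= Sgx.
rewrite (gE x); apply: cS => //.
by rewrite t0 ltW.
Qed.

(** A point [y] of [S] beyond the tangent plane would put [a] strictly between [y] and a point
    inside the ball, hence in the interior. Uniqueness is the equality case of Cauchy-Schwarz. *)
Lemma touching_ball S c a (r : R) : convex_combinations S -> 0 < r ->
  (forall x, inner (x - c) (x - c) <= r ^+ 2 -> S x) ->
  S a -> ~ S° a -> inner (a - c) (a - c) <= r ^+ 2 ->
  regular_boundary S a /\ outward_normal S a (r^-1 *: (a - c)).
Proof.
move=> cS r0 BS Sa Ia ac.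
have BI x : inner (x - c) (x - c) < r ^+ 2 -> S° x.
  by move=> xr; exact: interior_inner_ball BS xr.
have acE : inner (a - c) (a - c) = r ^+ 2.
  by apply/eqP; rewrite eq_le ac leNgt; apply/negP => /BI.
have bd : boundary S a by split => //; exact: subset_closure.
have normal : outward_normal S a (r^-1 *: (a - c)).
  split => //.
    rewrite /enorm innerZl innerZr acE -[RHS]sqrtr1; congr Num.sqrt.
    by field; rewrite gt_eqF.
  move=> y Sy; rewrite innerZr pmulr_rle0 ?invr_gt0// leNgt; apply/negP => g0.
  set g := inner _ _ in g0; pose N := inner (y - a) (y - a).
  have N0 : 0 <= N by exact: inner_ge0.
  (* With [s * N < g], stepping back from [a] by [s (y - a)] lowers the squared distance to [c] by
     [s (2 g - s N) > 0]. *)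
  pose s := g / (N + 1).
  have s0 : 0 < s by rewrite divr_gt0// ltr_wpDl.
  have sN : s * N < g.
    by rewrite /s mulrAC ltr_pdivrMr ?ltr_wpDl// ltr_pM2l// ltrDl.
  pose z := a - s *: (y - a).
  have Iz : S° z.
    apply: BI; have -> : z - c = (a - c) - s *: (y - a) by rewrite /z addrAC.
    rewrite inner_subZ acE (inner_sym (a - c)) -/g -/N.
    have : 0 < s * (2 * g - s * N) by rewrite mulr_gt0//; lra.
    by lra.
  apply: Ia; pose t := s / (1 + s).
  have s10 : 1 + s != 0 by rewrite gt_eqF// ltr_wpDr// ltW.
  have -> : a = t *: y + (1 - t) *: z.
    apply/matrixP => i j; rewrite !mxE /t; field; exact: s10.
  apply: interior_convex => //; rewrite /t divr_ge0 ?ltW ?addr_gt0//=.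
  by rewrite ltr_pdivrMr ?addr_gt0// mul1r ltrDr.
split => //; split => //; exists (r^-1 *: (a - c)); split => // nu [_ nu1 Hnu].
have nunu : inner nu nu = 1 by rewrite -enorm_sq nu1 expr1n.
(* Any normal [nu] bounds this point of the ball, so that [inner (a - c) nu >= r = enorm (a - c)],
   which forces [a - c = r nu]. *)
have : S (c + r *: nu).
  by apply: BS; rewrite addrC addKr innerZl innerZr nunu mulr1 expr2.
move/Hnu; have -> : c + r *: nu - a = r *: nu - (a - c) by rewrite opprB addrCA addrA.
rewrite innerBl innerZl nunu mulr1 => h.
have /inner_eq0 : inner (a - c - r *: nu) (a - c - r *: nu) = 0.
  apply/eqP; rewrite eq_le inner_ge0 andbT.
  rewrite inner_subZ nunu acE.
  have : 0 <= r * (inner (a - c) nu - r) by rewrite mulr_ge0//; lra.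
  by lra.
move/eqP; rewrite subr_eq0 => /eqP ->.
by rewrite scalerA mulVf ?gt_eqF// scale1r.
Qed.

(* Shrink the ball [B(d, e)] towards [p] by homotheties of centre [p]: the first
   one that meets the complement of the interior touches the boundary of [S], and
   the normal there is unique. Since even [B(d, 2 e)] lies in [S], the supporting
   hyperplane separates [p] strictly. *)
Lemma regular_separation S d p (e : R) : convex_combinations S -> closed S ->
  0 < e -> (forall x, inner (x - d) (x - d) <= (2 * e) ^+ 2 -> S x) -> ~ S p ->
  exists a nu, [/\ regular_boundary S a, outward_normal S a nu &
    0 < inner (p - a) nu].
Proof.
move=> cS clS e0 dS Sp.
pose E : set 'cV[R]_m := [set z | inner (z - d) (z - d) <= e ^+ 2].
pose h (x : R * 'cV[R]_m) := (1 - x.1) *: x.2 + x.1 *: p.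
have ch : continuous h.
  move=> x; have c1 : (fun y : R * 'cV[R]_m => y.1) @ x --> x.1 by exact: cvg_fst.
  have c2 : (fun y : R * 'cV[R]_m => y.2) @ x --> x.2 by exact: cvg_snd.
  exact: (cvgD (cvgZ (cvgB (cvg_cst (1 : R)) c1) c2) (cvgZ c1 (cvg_cst p))).
(* Pairs of a homothety parameter and a point of the ball whose image is outside the interior of
   [S]. At parameter [1] every image is [p], so [A] is nonempty; being compact, it has a least
   parameter [t]. *)
pose A : set (R * 'cV[R]_m)%type := (`[0, 1] `*` E) `&` h @^-1` (~` S°).
have EI z : E z -> S° z.
  move=> Ez; apply: (interior_inner_ball dS); apply: (le_lt_trans Ez).
  by rewrite exprMn ltr_pMl ?exprn_gt0// expr2; lra.
have [[t z]] : exists2 x : R * 'cV[R]_m, x \in A &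
    forall y : R * 'cV[R]_m, y \in A -> x.1 <= y.1.
  apply: (@compact_EVT_min _ R (@fst R 'cV[R]_m) A).
  - exists (1, d); split; first split => /=.
    + by rewrite in_itv /= ler01 lexx.
    + by rewrite /E /= subrr -(scale0r 0) innerZl mul0r sqr_ge0.
    + by rewrite /h /= subrr scale0r add0r scale1r => /interior_subset.
  - apply: compact_closedI.
      by apply: compact_setX; [exact: segment_compact|exact: compact_inner_ball_cV].
    apply: preimage_closed; first by move=> x _; exact: ch.
    exact/open_closedC/open_interior.
  - by apply: continuous_subspaceT => x; exact: cvg_fst.
move=> /set_mem[[t01 Ez] hz] tmin.
move: t01; rewrite /= in_itv => /andP[/= t0 t1].
have {}t0 : 0 < t.
  rewrite lt_neqAle t0 andbT; apply/negP => /eqP t00; apply: hz.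
  by rewrite /h /= -t00 subr0 scale1r scale0r addr0; exact: EI.
(* An image outside the closed set [S] at time [t] would already be outside at a slightly earlier
   time, against the minimality of [t]. *)
have hS z' : E z' -> S (h (t, z')).
  move=> Ez'; apply: contrapT => nS.
  have : nbhs (h (t, z')) (~` S).
    by apply: open_nbhs_nbhs; split => //; exact: closed_openC.
  have c2 : {for t, continuous (fun s => h (s, z'))}.
    have c1 : (fun s : R => s) @ t --> t by exact: cvg_id.
    exact: (cvgD (cvgZ (cvgB (cvg_cst (1 : R)) c1) (cvg_cst z')) (cvgZ c1 (cvg_cst p))).
  move=> /c2 /nbhs_ballP[r /= r0 Hr].
  pose t' := Num.max 0 (t - r / 2).
  have t't : t' < t by rewrite gt_max t0 ltrBlDr ltrDl divr_gt0.
  suff /tmin : (t', z') \in A by rewrite /= leNgt t't.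
  apply: mem_set; split; first split => //=.
    by rewrite in_itv /= le_max lexx (le_trans (ltW t't)).
  move=> /interior_subset; apply: Hr; rewrite -ball_normE /ball_ /=.
  rewrite ger0_norm ?subr_ge0 1?ltW// ltrBlDr -ltrBlDl lt_max; apply/orP; right.
  by rewrite ltrD2l ltrN2 ltr_pdivrMr// ltr_pMr// ltrDl.
have {}t1 : t < 1.
  rewrite lt_neqAle t1 andbT; apply/negP => /eqP t11; apply: Sp.
  by have := hS z Ez; rewrite /h /= t11 subrr scale0r add0r scale1r.
have t10 : 0 < 1 - t by rewrite subr_gt0.
pose a := h (t, z); pose c := h (t, d).
have diffE x y : h (t, x) - h (t, y) = (1 - t) *: (x - y).
  by rewrite /h /= opprD addrACA subrr addr0 scalerBr.
have BS x : inner (x - c) (x - c) <= ((1 - t) * e) ^+ 2 -> S x.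
  move=> xc; have -> : x = h (t, d + (1 - t)^-1 *: (x - c)).
    rewrite -[LHS](subrK c) -[RHS](subrK c) diffE (addrC d) addrK scalerA.
    by rewrite divff ?gt_eqF// scale1r.
  apply: hS; rewrite /E /= (addrC d) addrK innerZl innerZr mulrA -expr2 exprVn.
  by rewrite mulrC ler_pdivrMr ?exprn_gt0// -exprMn mulrC.
have ac : inner (a - c) (a - c) <= ((1 - t) * e) ^+ 2.
  by rewrite diffE innerZl innerZr mulrA -expr2 exprMn ler_wpM2l// sqr_ge0.
have r0 : 0 < (1 - t) * e by rewrite mulr_gt0.
have [reg nor] := touching_ball cS r0 BS (hS z Ez) hz ac.
set nu := _ *: (a - c) in nor.
exists a, nu; split => //.
have [_ nu1 Hnu] := nor.
have nunu : inner nu nu = 1 by rewrite -enorm_sq nu1 expr1n.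
(* This point gives [(d, nu) + 2 e <= (a, nu)], while [a = (1 - t) d + t p + (1 - t) e nu]. If
   [(p, nu) <= (a, nu)], the two would yield [(a, nu) <= (a, nu) - (1 - t) e]. *)
have : S (d + (2 * e) *: nu).
  by apply: dS; rewrite (addrC d) addrK innerZl innerZr nunu mulr1 expr2.
move/Hnu; rewrite !innerBl innerDl innerZl nunu mulr1 => h1.
have h2 : inner a nu = (1 - t) * inner d nu + t * inner p nu + (1 - t) * e.
  have -> : a = c + ((1 - t) * e) *: nu.
    by rewrite /nu scalerA divff ?gt_eqF// scale1r addrC subrK.
  by rewrite innerDl innerZl nunu mulr1 /c /h /= innerDl !innerZl.
rewrite subr_gt0 ltNge; apply/negP => h3.
have : (1 - t) * (inner d nu + 2 * e - inner a nu) <= 0 by rewrite pmulr_rle0.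
have : t * (inner p nu - inner a nu) <= 0 by rewrite pmulr_rle0// subr_le0.
by lra.
Qed.

(** The open set whose closure is [S] contains a ball of some radius [e]; separation is applied with
    [e / 2], so that the doubled ball is this one. *)
Lemma convex_body_halfspaces S p : convex_body S ->
  (forall a nu, regular_boundary S a -> outward_normal S a nu ->
     inner (p - a) nu <= 0) -> S p.
Proof.
move=> [D [oD cD [d Dd] _ ->]] H; apply: contrapT => np.
have [e e0 He] := nbhs_inner_ball (open_nbhs_nbhs (conj oD Dd)).
have [||||a [nu [ra na]]] := @regular_separation (closure D) d p (e / 2) _ _ _ _ np.
- by move=> y z t *; exact: closure_convex.
- exact: closed_closure.
- by rewrite divr_gt0.
- move=> x xd; apply/subset_closure/He.
  by rewrite (_ : 2 * (e / 2) = e) in xd; last by field.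
by rewrite ltNge H.
Qed.

End ConvexBodies.

(** * Maximum principle *)

(** On a line the exponent of a Gaussian is a quadratic polynomial, so these two derivatives are all
    that the barrier requires. *)
Lemma expR_quadratic_derive (R : realType) (c a0 a1 a2 t : R) :
  is_derive t 1 (fun t => c * expR (a0 + a1 * t + a2 * t ^+ 2))
    (c * expR (a0 + a1 * t + a2 * t ^+ 2) * (a1 + 2 * a2 * t)).
Proof.
have d1 : is_derive t 1 (fun t : R => a0 + a1 * t + a2 * t ^+ 2) (a1 + 2 * a2 * t).
  apply: is_derive_eq; rewrite /GRing.scale /=; ring.
have d2 := is_derive1_comp (is_derive_expR _) d1.
by have := is_deriveZ c d2; congr (is_derive _ _ _ _); rewrite /GRing.scale /=; ring.
Qed.

Lemma expR_quadratic_derive2 (R : realType) (c a0 a1 a2 : R) :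
  is_derive (0 : R) 1
    (fun t => c * expR (a0 + a1 * t + a2 * t ^+ 2) * (a1 + 2 * a2 * t))
    (c * expR a0 * (a1 ^+ 2 + 2 * a2)).
Proof.
have d1 := expR_quadratic_derive c a0 a1 a2 0.
have d2 : is_derive (0 : R) 1 (fun t : R => a1 + 2 * a2 * t) (2 * a2).
  apply: is_derive_eq; rewrite /GRing.scale /=; ring.
have := is_deriveM d1 d2; congr (is_derive _ _ _ _).
by rewrite /GRing.scale /= expr0n /= !mulr0 !addr0; ring.
Qed.

Section MaximumPrinciple.
Variables (R : realType) (n : nat) (Omega : set 'rV[R]_n) (w : 'rV[R]_n -> R).
Variables (P : 'I_n -> 'rV[R]_n -> R) (Q : 'I_n -> 'I_n -> 'rV[R]_n -> R).
Variables (b : 'rV[R]_n -> 'I_n -> 'I_n -> R) (delta T : R).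
Hypotheses (oOmega : open Omega) (cw : {within closure Omega, continuous w}).
Hypothesis dw : forall j x, Omega x -> is_derive x (delta_mx 0 j) w (P j x).
Hypothesis dP : forall i j x, Omega x -> is_derive x (delta_mx 0 i) (P j) (Q i j x).
Hypothesis cP : forall j, {in Omega, continuous (P j)}.
Hypothesis cQ : forall i j, {in Omega, continuous (Q i j)}.
Hypotheses (delta0 : 0 < delta) (T0 : 0 <= T).
Hypothesis bsym : forall x i j, Omega x -> b x i j = b x j i.
Hypothesis bell : forall x (s : 'rV[R]_n), Omega x ->
  delta * inner s s <= \sum_i \sum_j s 0 i * s 0 j * b x i j.
Hypothesis btr : forall x, Omega x -> \sum_i b x i i <= T.
Hypothesis weq : forall x, Omega x -> \sum_i \sum_j b x i j * Q i j x = 0.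
Hypothesis wbd : forall x, boundary Omega x -> w x <= 0.

(* [exp (- al |x - y|^2)] is a strict subsolution of the equation outside the
   ball [B(y, rho)] as soon as [T < 2 al delta rho^2]. *)
Lemma barrier_bound (M al rho L : R) (y : 'rV[R]_n) :
  0 < M -> (forall x, Omega x -> w x <= M) -> 0 < al ->
  T < 2 * al * (delta * rho ^+ 2) ->
  (forall x, Omega x -> rho ^+ 2 <= inner (x - y) (x - y)) ->
  forall x, Omega x -> inner (x - y) (x - y) < L ->
    w x <= M * (1 - (expR (- al * inner (x - y) (x - y)) - expR (- al * L))).
Proof.
move=> M0 wM al0 TL far x0 Ox0 x0L; rewrite leNgt; apply/negP => w0.
pose q (x : 'rV[R]_n) := inner (x - y) (x - y).
pose f x := w x + M * expR (- al * q x).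
pose K := [set x | q x <= L] `&` closure Omega.
have cq : continuous q by exact: continuous_inner_dist.
have [x xK fmax] : exists2 x, x \in K & forall z, z \in K -> f z <= f x.
  apply: compact_EVT_max.
  - by exists x0; split; [exact: ltW|exact: subset_closure].
  - by apply: compact_closedI; [exact: compact_inner_ball_rV|exact: closed_closure].
  - have cw' : {within K, continuous w} by apply: continuous_subspaceW cw => z [].
    have cg : {within K, continuous (fun z => M * expR (- al * q z))}.
      apply: continuous_subspaceT => z.
      have h : (fun z => - al * q z) @ z --> - al * q z.
        exact: (cvgM (cvg_cst _) (cq z)).
      have h2 : (fun z => expR (- al * q z)) @ z --> expR (- al * q z).
        exact: (cvg_comp _ _ h (@continuous_expR R (- al * q z))).
      exact: (cvgM (cvg_cst M) h2).
    by move=> z; exact: (cvgD (cw' z) (cg z)).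
move: xK => /set_mem[/= xL clx].
(* On the boundary of [Omega] the value of [f] is at most [M], and at points of [Omega] with [q = L]
   at most [M + M * expR (- al * L)]. So the maximum is attained at an interior point of [K]. *)
have fx : M + M * expR (- al * L) < f x.
  apply: (@lt_le_trans _ _ (f x0)).
    by move: w0; rewrite /f -/(q x0); lra.
  by apply: fmax; apply: mem_set; split; [exact: ltW|exact: subset_closure].
have e1 : expR (- al * q x) <= 1.
  by rewrite -expR0 ler_expR mulNr oppr_le0 mulr_ge0 ?inner_ge0// ltW.
have Ox : Omega x.
  apply: contrapT => nOx.
  have wx : w x <= 0.
    by apply: wbd; split => //; rewrite (interior_id Omega).1.
  have : M * expR (- al * q x) <= M * 1 by rewrite ler_pM2l.
  have : 0 < M * expR (- al * L) by rewrite mulr_gt0// expR_gt0.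
  by rewrite /f in fx; lra.
have {}xL : q x < L.
  rewrite lt_neqAle xL andbT; apply/negP => /eqP qL.
  by have := wM _ Ox; rewrite /f qL in fx; lra.
pose U := Omega `&` [set z | q z < L].
have oU : open U.
  apply: openI => //; apply: (@open_comp _ _ q [set z | z < L]) => [z _|].
    exact: cq.
  exact: open_lt.
pose z := x - y; pose c := M * expR (- al * q x).
have c0 : 0 < c by rewrite mulr_gt0// expR_gt0.
have Hdir (s : 'rV[R]_n) : \sum_i \sum_j s 0 i * s 0 j * Q i j x +
    c * ((- al * 2 * inner z s) ^+ 2 + 2 * (- al * inner s s)) <= 0.
  move: s.
  pose a1 s := - al * 2 * inner z s; pose a2 (s : 'rV[R]_n) := - al * inner s s.
  apply: (@second_directional_at_max R n w P Q U x
    (fun s t => M * expR (- al * q x + a1 s * t + a2 s * t ^+ 2))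
    (fun s t => M * expR (- al * q x + a1 s * t + a2 s * t ^+ 2) * (a1 s + 2 * a2 s * t))
    (fun s => c * (a1 s ^+ 2 + 2 * a2 s))) => //.
  - by move=> j v [Ov _]; exact: dw.
  - by move=> i j v [Ov _]; exact: dP.
  - by move=> j v /set_mem[Ov _]; apply: cP; exact: mem_set.
  - by move=> i j v /set_mem[Ov _]; apply: cQ; exact: mem_set.
  - by move=> s t; exact: expR_quadratic_derive.
  - by move=> s; exact: expR_quadratic_derive2.
  - move=> s t [Ov /ltW vL].
    rewrite expr0n /= !mulr0 !addr0.
    have -> : - al * q x + a1 s * t + a2 s * t ^+ 2 = - al * q (x + t *: s).
      have -> : q (x + t *: s) = inner (z - (- t) *: s) (z - (- t) *: s).
        by rewrite /q /z scaleNr opprK addrAC.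
      by rewrite inner_subZ /a1 /a2 /q -/z; ring.
    by apply: fmax; apply: mem_set; split => //; exact: subset_closure.
(* The Hessian of [f] at [x]; the Gaussian contributes [c] times [4 al^2 z z^T - 2 al I]. *)
pose H i j := Q i j x + c * (4 * al ^+ 2 * (z 0 i * z 0 j) - (2 * al) * (i == j)%:R).
have rowE (s : 'I_n -> R) (F : 'I_n -> 'I_n -> R) :
    \sum_i \sum_j (\row_k s k) 0 i * (\row_k s k) 0 j * F i j =
    \sum_i \sum_j s i * s j * F i j.
  by apply: eq_bigr => i _; apply: eq_bigr => j _; rewrite !mxE.
have diagE (G : 'I_n -> 'I_n -> R) : \sum_i \sum_j G i j * (i == j)%:R = \sum_i G i i.
  apply: eq_bigr => i _; rewrite (bigD1 i)//= eqxx mulr1 big1 ?addr0// => j ji.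
  by rewrite eq_sym (negbTE ji) mulr0.
have sumH (G : 'I_n -> 'I_n -> R) : \sum_i \sum_j G i j * H i j =
    \sum_i \sum_j G i j * Q i j x +
    c * (4 * al ^+ 2 * (\sum_i \sum_j z 0 i * z 0 j * G i j) - 2 * al * \sum_i G i i).
  rewrite -diagE mulrBr !mulr_sumr -sumrB -big_split; apply: eq_bigr => i _ /=.
  rewrite !mulr_sumr -sumrB -big_split; apply: eq_bigr => j _ /=.
  by rewrite /H; ring.
have : \sum_i \sum_j b x i j * H i j <= 0.
  apply: posdef_negsemidef_trace_le0 => [i j|s i si|s].
  - exact: bsym.
  - rewrite -rowE; apply: lt_le_trans (bell (\row_k s k) Ox).
    rewrite mulr_gt0//; apply: lt_le_trans (sq_entry_le_inner _ 0 i).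
    by rewrite mxE exprn_even_gt0.
  - have := Hdir (\row_k s k); rewrite rowE; congr (_ <= _).
    rewrite sumH; congr (_ + c * _).
    have -> : inner (\row_k s k) (\row_k s k) = \sum_i s i * s i.
      by rewrite /inner big_ord1; apply: eq_bigr => i _; rewrite !mxE.
    have -> : \sum_i \sum_j z 0 i * z 0 j * (s i * s j) = (inner z (\row_k s k)) ^+ 2.
      rewrite /inner big_ord1 expr2 mulr_suml; apply: eq_bigr => i _.
      rewrite mulr_sumr; apply: eq_bigr => j _; rewrite !mxE; ring.
    by ring.
(* The equation removes the part from [w]. What remains is at least [4 al^2 delta rho^2 - 2 al T],
   which is positive by the choice of [al]. *)
rewrite sumH weq// add0r pmulr_rle0// => h1.
have h2 : delta * rho ^+ 2 <= \sum_i \sum_j z 0 i * z 0 j * b x i j.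
  by apply: le_trans (bell z Ox); rewrite ler_pM2l//; exact: far.
have h3 := btr Ox.
have : 4 * al ^+ 2 * (delta * rho ^+ 2) <=
    4 * al ^+ 2 * \sum_i \sum_j z 0 i * z 0 j * b x i j.
  by rewrite ler_wpM2l// mulr_ge0// sqr_ge0.
have : 2 * al * \sum_i b x i i <= 2 * al * T by rewrite ler_wpM2l// mulr_ge0// ltW.
have : 2 * al * T < 2 * al * (2 * al * (delta * rho ^+ 2)).
  by rewrite ltr_pM2l// mulr_gt0.
by lra.
Qed.

(* The comparison with the barrier gains a factor [1 - th < 1] that is the same at
   all points, so that the supremum of [w] cannot be positive. *)
Lemma maximum_principle (kappa M0 : R) :
  (forall x, Omega x -> w x <= M0) ->
  (forall x0, Omega x0 -> exists y rho, [/\ 0 < rho,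
     forall x, Omega x -> rho ^+ 2 <= inner (x - y) (x - y) &
     inner (x0 - y) (x0 - y) <= kappa * rho ^+ 2]) ->
  forall x, Omega x -> w x <= 0.
Proof.
move=> wM0 geom x0 Ox0; rewrite leNgt; apply/negP => wx0.
have kappa0 : 0 < kappa.
  have [y [rho [rho0 far near]]] := geom _ Ox0.
  have rho20 : 0 < rho ^+ 2 by rewrite exprn_gt0.
  rewrite -(pmulr_lgt0 _ rho20); apply: lt_le_trans near.
  exact: lt_le_trans (far _ Ox0).
have supE : has_sup (w @` Omega).
  by split; [exists (w x0), x0|exists M0 => _ [x Ox <-]; exact: wM0].
pose M := sup (w @` Omega).
have wM x : Omega x -> w x <= M by move=> Ox; apply: sup_upper_bound => //; exists x.
have Mpos : 0 < M by exact: lt_le_trans (wM _ Ox0).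
(* With [al = N / rho^2] the barrier condition reads [T < 2 delta N = T + 2 delta], whatever [rho]
   is. *)
pose N := T / (2 * delta) + 1.
have N0 : 0 < N by rewrite ltr_wpDl// divr_ge0// mulr_ge0// ltW.
(* The gain of the barrier with [L = 2 kappa rho^2] at squared distance [kappa rho^2]; the radius
   cancels. *)
pose th := expR (- N * kappa) - expR (- N * (2 * kappa)).
have th0 : 0 < th.
  rewrite subr_gt0 ltr_expR !mulNr ltrN2 ltr_pM2l//; lra.
suff : M <= M * (1 - th).
  have : 0 < M * th by rewrite mulr_gt0.
  by lra.
apply: ge_sup; first exact: supE.1.
move=> _ [x Ox <-].
have [y [rho [rho0 far near]]] := geom _ Ox.
have rho20 : 0 < rho ^+ 2 by rewrite exprn_gt0.
pose al := N / rho ^+ 2.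
have al0 : 0 < al by rewrite divr_gt0.
have alr : al * rho ^+ 2 = N by rewrite /al divfK// gt_eqF.
have TL : T < 2 * al * (delta * rho ^+ 2).
  have -> : 2 * al * (delta * rho ^+ 2) = 2 * delta * N by rewrite -alr; ring.
  rewrite mulrDr mulr1 mulrCA divff ?mulr1 ?ltrDl ?mulr_gt0//.
  by rewrite mulf_neq0// gt_eqF.
have xL : inner (x - y) (x - y) < 2 * kappa * rho ^+ 2.
  by apply: le_lt_trans near _; rewrite ltr_pM2r//; lra.
apply: le_trans (barrier_bound Mpos wM al0 TL far Ox xL) _.
rewrite ler_pM2l// lerD2l lerN2 lerB// ler_expR !mulNr lerN2.
  have : al * inner (x - y) (x - y) <= al * (kappa * rho ^+ 2) by rewrite ler_pM2l.
  by rewrite -alr; lra.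
by rewrite -alr; lra.
Qed.

End MaximumPrinciple.

(** * Exterior balls and invariance *)

(** The boundedness of the coefficients and of [u] is given in the sup norm; a crude constant
    suffices to transfer it to inner products. *)
Lemma inner_le_norm (R : realType) (p q : nat) (v w : 'M[R]_(p, q)) :
  inner v w <= (p * q)%:R * (`|v| * enorm w).
Proof.
have le_entry i j : v i j * w i j <= `|v| * enorm w.
  rewrite (le_trans (ler_norm _))// normrM ler_pM ?entry_le_enorm//.
  by rewrite [leRHS]/Num.Def.normr /= mx_normrE; exact: (le_bigmax _ _ (i, j)).
apply: (@le_trans _ _ (\sum_(i < p) \sum_(j < q) `|v| * enorm w)).
  by apply: ler_sum => i _; apply: ler_sum => j _.
by rewrite !sumr_const !card_ord -mulrnA mulr_natl mulnC.
Qed.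

Lemma norm_mulmx_le (R : realType) (p q r : nat) (A : 'M[R]_(p, q)) (B : 'M[R]_(q, r)) :
  `|A *m B| <= q%:R * (`|A| * `|B|).
Proof.
have entry (s t : nat) (C : 'M[R]_(s, t)) i j : `|C i j| <= `|C|.
  by rewrite [leRHS]/Num.Def.normr /= mx_normrE; exact: (le_bigmax _ _ (i, j)).
rewrite [leLHS]/Num.Def.normr /= mx_normrE; apply: bigmax_le => [|[i j] _ /=].
  by rewrite !mulr_ge0.
rewrite mxE (le_trans (ler_norm_sum _ _ _))//.
apply: (@le_trans _ _ (\sum_(k < q) `|A| * `|B|)).
  by apply: ler_sum => k _; rewrite normrM ler_pM.
by rewrite sumr_const card_ord mulr_natl.
Qed.

Lemma inner_mulmx (R : realType) (p : nat) (A : 'M[R]_p) (v w : 'cV[R]_p) :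
  inner (A *m v) w = inner v (A^T *m w).
Proof.
rewrite /inner.
under eq_bigr do rewrite big_ord1 mxE mulr_suml.
under [RHS]eq_bigr do rewrite big_ord1 mxE mulr_sumr.
rewrite exchange_big; apply: eq_bigr => i _; apply: eq_bigr => j _.
by rewrite mxE; ring.
Qed.

Lemma is_derive_inner (R : realType) (V : normedModType R) (p q : nat)
    (u : V -> 'M[R]_(p, q)) (a nu : 'M[R]_(p, q)) (x v : V) :
  derivable u x v -> is_derive x v (fun y => inner (u y - a) nu) (inner ('D_v u x) nu).
Proof.
move=> du.
have H : (fun h => h^-1 *: (((fun y => inner (u y - a) nu) \o shift x) (h *: v) -
    inner (u x - a) nu)) @ 0^' --> inner ('D_v u x) nu.
  have -> : (fun h => h^-1 *: (((fun y => inner (u y - a) nu) \o shift x) (h *: v) -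
      inner (u x - a) nu)) =
    (fun h => inner (h^-1 *: ((u \o shift x) (h *: v) - u x)) nu).
    apply/funext => h; rewrite innerZl; congr (_ * _).
    by rewrite /= -innerBl opprB addrA subrK.
  exact: (cvg_inner _ du (cvg_cst nu)).
by split; [apply/cvg_ex; exists (inner ('D_v u x) nu)|exact: cvg_lim].
Qed.

(** One ball serves all points: [Omega] lies in the cube of half-side [T], and the centre has all
    coordinates [2 T], so each coordinate of [x - y] has absolute value between [T] and [3 T]. *)
Lemma exterior_balls_bounded (R : realType) (n : nat) (Omega : set 'rV[R]_n.+1) :
  bounded_set Omega ->
  exists kappa, forall x0, Omega x0 -> exists y rho, [/\ 0 < rho,
    forall x, Omega x -> rho ^+ 2 <= inner (x - y) (x - y) &
    inner (x0 - y) (x0 - y) <= kappa * rho ^+ 2].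
Proof.
move=> [M [_ HM]].
pose T := `|M| + 1.
have T0 : 0 < T by rewrite ltr_wpDl.
have xT x j : Omega x -> `|x 0 j| <= T.
  move=> Ox; have MT : M < T by rewrite /T (le_lt_trans (ler_norm M))// ltrDl.
  apply: le_trans (HM _ MT _ Ox).
  by rewrite [leRHS]/Num.Def.normr /= mx_normrE; exact: (le_bigmax _ _ (0, j)).
exists ((n.+1)%:R * 9) => x0 Ox0; exists (const_mx (2 * T)), T; split => // [x Ox|].
  apply: le_trans (sq_entry_le_inner _ 0 ord0); rewrite !mxE.
  have := xT _ ord0 Ox; rewrite ler_norml => /andP[_ xl].
  by rewrite -[leRHS]sqrrN ler_sqr ?nnegrE; lra.
rewrite /inner big_ord1.
apply: (@le_trans _ _ (\sum_(j < n.+1) 9 * T ^+ 2)); last first.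
  by rewrite sumr_const card_ord -[leLHS]mulr_natl mulrA.
apply: ler_sum => j _; rewrite !mxE -expr2 (_ : 9 * T ^+ 2 = (3 * T) ^+ 2); last by ring.
have := xT _ j Ox0; rewrite ler_norml => /andP[xl xr].
by rewrite -[leLHS]sqrrN ler_sqr ?nnegrE; lra.
Qed.

(** The ball is centred on the axis of the cone at depth [r], with radius proportional to [r]; by
    homogeneity [kappa] depends on [h] only. *)
Lemma exterior_balls_cone (R : realType) (n : nat) (Omega : set 'rV[R]_n.+1) (h : R) :
  1 < h -> cone h `<=` ~` Omega ->
  exists kappa, forall x0, Omega x0 -> exists y rho, [/\ 0 < rho,
    forall x, Omega x -> rho ^+ 2 <= inner (x - y) (x - y) &
    inner (x0 - y) (x0 - y) <= kappa * rho ^+ 2].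
Proof.
move=> h1 hc; exists (16 * h ^+ 2) => x0 Ox0.
pose A (x : 'rV[R]_n.+1) := \sum_(i < n.+1 | i != ord_max) x 0 i ^+ 2.
(* This bounds the length of [x0] without a square root, since [e <= (1 + e)^2] for [e >= 0]. *)
pose r := 1 + inner x0 x0.
have r0 : 0 < r by rewrite ltr_wpDr// inner_ge0.
have h0 : 0 < h by lra.
have A0 x : 0 <= A x by apply: sumr_ge0 => i _; exact: sqr_ge0.
have distE (x : 'rV[R]_n.+1) (s : R) :
    inner (x - (- s) *: delta_mx 0 ord_max) (x - (- s) *: delta_mx 0 ord_max) =
    A x + (x 0 ord_max + s) ^+ 2.
  rewrite /inner big_ord1 (bigD1 ord_max)//= addrC; congr (_ + _).
    by apply: eq_bigr => i /negbTE im; rewrite !mxE im mulr0 subr0 expr2.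
  by rewrite !mxE !eqxx mulr1 opprK expr2.
exists ((- r) *: delta_mx 0 ord_max), (r / (2 * h)); split.
- by rewrite divr_gt0// mulr_gt0.
- move=> x Ox; rewrite distE.
  have h20 : 0 < h ^+ 2 by rewrite exprn_gt0.
  rewrite expr_div_n ler_pdivrMr ?exprn_gt0 ?mulr_gt0// exprMn.
  set t := x 0 ord_max.
  have hh : 1 <= h ^+ 2 by rewrite expr_ge1 ?ltW.
  have tr0 : 0 <= (t + r) ^+ 2 by exact: sqr_ge0.
  have htr : (t + r) ^+ 2 <= h ^+ 2 * (t + r) ^+ 2 by rewrite ler_peMl.
  have hA : 0 <= h ^+ 2 * A x by rewrite mulr_ge0// ltW.
  have [t0|t0] := leP 0 t.
    have : r ^+ 2 <= (t + r) ^+ 2 by rewrite ler_sqr ?nnegrE; lra.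
    by lra.
  have tA : t ^+ 2 <= h ^+ 2 * A x.
    by rewrite leNgt; apply/negP => lt; exact: (hc x).
  (* Outside the cone, [4 h^2] times the squared distance is at least [4 t^2 + 4 (t + r)^2 = 2 (2 t
     + r)^2 + 2 r^2]. *)
  have : 0 <= (2 * t + r) ^+ 2 by exact: sqr_ge0.
  by lra.
- rewrite distE (_ : 16 * h ^+ 2 * (r / (2 * h)) ^+ 2 = 4 * r ^+ 2); last first.
    by field; rewrite gt_eqF.
  set t := x0 0 ord_max.
  have E : inner x0 x0 = A x0 + t ^+ 2.
    by have := distE x0 0; rewrite oppr0 scale0r subr0 addr0.
  (* This is [(t + r)^2 <= 2 t^2 + 2 r^2]. *)
  have : 0 <= (t - r) ^+ 2 by exact: sqr_ge0.
  have : 0 <= t ^+ 2 by exact: sqr_ge0.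
  have : inner x0 x0 <= r ^+ 2.
    have := inner_ge0 x0; rewrite /r.
    set e := inner x0 x0; move=> e0; have : 0 <= e ^+ 2 by exact: sqr_ge0.
    by lra.
  have := A0 x0; rewrite E; lra.
Qed.

Unset Implicit Arguments.
Set Strict Implicit.
Set Printing Implicit Defensive.

Theorem theorem2 (R : realType) (n m : nat) (Omega : set 'rV[R]_n.+1)
  (hdom : is_domain Omega)
  (hOmega : bounded_set Omega \/
     (~ bounded_set Omega /\ exists2 h : R, 1 < h & cone h `<=` ~` Omega))
  (B : 'I_n.+1 -> 'I_n.+1 -> 'rV[R]_n.+1 -> 'M[R]_(m, n.+1) -> 'M[R]_m)
  (hsym : forall j k x eta, Omega x -> B j k x eta = B k j x eta)
  (hbnd : forall j k,
     [bounded B j k p.1 p.2 | p in Omega `*` [set: 'M[R]_(m, n.+1)]])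
  (hell : strongly_elliptic Omega B)
  (S : set 'cV[R]_m) (hS : convex_body S)
  (b : 'I_n.+1 -> 'I_n.+1 -> 'rV[R]_n.+1 -> 'M[R]_(m, n.+1) -> 'cV[R]_m -> R)
  (hb : forall j k x eta nu, Omega x -> normals S nu ->
     (B j k x eta)^T *m nu = b j k x eta nu *: nu) :
  invariant_for (quasilinear_op B) Omega S.
Proof.
move=> u [cu du ddu] wu bu Lu Su x Ox.
apply: (convex_body_halfspaces hS) => a nu ra na.
have [_ nu1 Hnu] := na.
have nunu : inner nu nu = 1 by rewrite -enorm_sq nu1 expr1n.
have Nnu : normals S nu by exists a.
have [oOmega _ _] := hdom.
have [delta delta0 ell] := hell.
(* The eigenvalue [b] along the solution, recovered as a quadratic form at the unit vector [nu];
   symmetry and bounds then come from those of [B]. *)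
pose beta z i j := inner (B i j z (grad u z) *m nu) nu.
have betaE z i j : Omega z -> (B i j z (grad u z))^T *m nu = beta z i j *: nu.
  move=> Oz; rewrite /beta inner_mulmx (hb _ _ _ _ _ Oz Nnu).
  by rewrite innerZr nunu mulr1.
have [kappa geom] : exists kappa : R, forall x0, Omega x0 -> exists y rho, [/\ 0 < rho,
    forall x, Omega x -> rho ^+ 2 <= inner (x - y) (x - y) &
    inner (x0 - y) (x0 - y) <= kappa * rho ^+ 2].
  case: hOmega => [|[_ [h h1 hc]]]; first exact: exterior_balls_bounded.
  exact: exterior_balls_cone h1 hc.
have [T T0 btr] : exists2 T : R, 0 <= T & forall z, Omega z -> \sum_i beta z i i <= T.
  have bd i : exists C : R, forall z, Omega z -> beta z i i <= `|C|.
    have [C [_ HC]] := hbnd i i.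
    exists ((m * 1)%:R * ((m%:R * (`|C + 1| * enorm nu)) * enorm nu)) => z Oz.
    have BC : `|B i i z (grad u z)| <= `|C + 1|.
      by apply: le_trans (ler_norm _); apply: (HC (C + 1) _ (z, grad u z)) => //; rewrite ltrDl.
    rewrite (le_trans _ (ler_norm _))// (le_trans (inner_le_norm _ _))//.
    rewrite ler_wpM2l// ler_wpM2r ?sqrtr_ge0// (le_trans (norm_mulmx_le _ _))//.
    by rewrite ler_wpM2l// ler_pM// norm_le_enorm.
  have [C HC] := choice bd.
  exists (\sum_i `|C i|) => [|z Oz]; first exact: sumr_ge0.
  by apply: ler_sum => i _; exact: HC.
have [M0 wM0] : exists M0, forall z, Omega z -> inner (u z - a) nu <= M0.
  have [C [_ HC]] := bu.
  exists ((m * 1)%:R * ((C + 1 + `|a|) * enorm nu)) => z Oz.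
  rewrite (le_trans (inner_le_norm _ _))// ler_wpM2l// ler_wpM2r ?sqrtr_ge0//.
  rewrite (le_trans (ler_normB _ _))// lerD2r; apply: HC; first by rewrite ltrDl.
  exact: subset_closure.
(* The [- 0] gives the derivatives the shape [inner (_ - a) nu] of [is_derive_inner], which then
   serves for both orders. *)
have cinner (v : 'rV[R]_n.+1 -> 'cV[R]_m) :
    {in Omega, continuous v} -> {in Omega, continuous (fun z => inner (v z - 0) nu)}.
  move=> cv z Oz.
  have h : (fun z => v z - 0) @ z --> v z - 0 by exact: (cvgB (cv z Oz) (cvg_cst _)).
  exact: (cvg_inner _ h (cvg_cst nu)).
apply: (@maximum_principle R n.+1 Omega (fun z => inner (u z - a) nu)
  (fun j z => inner (pd j u z - 0) nu) (fun i j z => inner (pd i (pd j u) z - 0) nu)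
  beta delta T oOmega _ _ _ _ _ delta0 T0 _ _ btr _ _ kappa M0 wM0 geom x Ox).
- move=> z.
  have h : (fun z : subspace (closure Omega) => u z - a) @ z --> u z - a.
    exact: (cvgB (wu z) (cvg_cst _)).
  exact: (cvg_inner _ h (cvg_cst nu)).
- by move=> j z Oz; rewrite subr0; apply: is_derive_inner; exact: (du j).1.
- by move=> i j z Oz; rewrite subr0; apply: is_derive_inner; exact: (ddu i j).1.
- by move=> j; apply: cinner; exact: (du j).2.
- by move=> i j; apply: cinner; exact: (ddu i j).2.
- by move=> z i j Oz; rewrite /beta hsym.
(* Strong ellipticity with [zeta = nu] is exactly scalar ellipticity of [beta]. *)
- move=> z s Oz; have := ell (grad u z) s nu z Oz.
  rewrite nu1 expr1n mulr1 enorm_sq; congr (_ <= _).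
  rewrite mulmx_suml inner_suml; apply: eq_bigr => i _.
  rewrite mulmx_suml inner_suml; apply: eq_bigr => j _.
  by rewrite -scalemxAl innerZl.
(* Pairing the system with [nu] and transposing each [B] onto [nu] replaces the matrices by their
   eigenvalues [beta]. *)
- move=> z Oz.
  have Lnu : inner (quasilinear_op B u z) nu = 0.
    by rewrite Lu// -(subrr nu) innerBl subrr.
  rewrite -[RHS]Lnu /quasilinear_op inner_suml.
  apply: eq_bigr => i _; rewrite inner_suml; apply: eq_bigr => j _.
  by rewrite inner_mulmx betaE// innerZr subr0.
- by move=> z /Su /Hnu.
Qed.
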